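(* Let $K,L\ge 0$ be integers, $n=K+L+1$, and let $\mu=(K+1,1^L)$ be the corresponding hook partition of $n$. Let $\mathcal S$ be the set of all cross diagrams $S$ of drawings associated to $\mu$. Then the family $\{\partial_S\Delta_\mu\}_{S\in\mathcal S}$ is linearly independent.
   Context: Let $K,L\ge 0$, $n=K+L+1$, $\mu=(K+1,1^L)$. All polynomials are in $x_1,\dots,x_n,y_1,\dots,y_n$ over $\mathbb Q$. The set of biexponents of $\mu$ is $\{(0,0),(0,1),\dots,(0,K),(1,0),\dots,(L,0)\}$; list it in lexicographic order as $(p_1,q_1),\dots,(p_n,q_n)$ and set $\Delta_\mu=\det(x_i^{p_j}y_i^{q_j})_{1\le i,j\le n}$. A shape is a choice of $K$ of the places $1,\dots,K+L$ (numbered from left to right) to be $y$-columns, the $L$ other places being $x$-columns. From left to right the $y$-columns have $K,K-1,\dots,1$ cells and the $x$-columns have $L,L-1,\dots,1$ cells. A drawing $D$ consists of a shape together with, for each column, a number of crosses between $0$ and the number of cells of the column (cells without a cross are called white; only the number of crosses in each column matters), subject to the following rules. (1) The number of crosses in an $x$-column is arbitrary. (2) If a $y$-column has no $x$-column to its right, its number of crosses is arbitrary. If a $y$-column has some $x$-column to its right, consider the first (nearest) $x$-column to its right which is plain, i.e. all of whose cells are crossed (full) or all of whose cells are white (empty); one exists since the last $x$-column has one cell. If this plain $x$-column is empty, the $y$-column must have at least one cross; if it is full, the $y$-column must have at least one white cell. For a drawing $D$, its cross diagram $S$ is the diagram consisting only of the crosses of $D$: it records for each place the number of crossed $x$-cells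 and the number of crossed $y$-cells there (but not the shape of $D$; in particular a place without crosses carries no information on its column type). If $S$ has $a_i$ crossed $x$-cells and $b_i$ crossed $y$-cells at place $i$, then $\partial_S=\prod_{i=1}^{n-1}\partial_{x_i}^{a_i}\partial_{y_i}^{b_i}$. $\mathcal S$ is the set of the cross diagrams $S$ of all drawings. *)

(* Defs.v *)
From mathcomp Require Import all_boot all_order all_algebra.
From mathcomp Require Import mpoly.

Set Implicit Arguments.
Unset Strict Implicit.
Unset Printing Implicit Defensive.

Import GRing.Theory.
Local Open Scope ring_scope.

(* Linear independence of the family (f i), i in A; the members of the family
   are in particular pairwise distinct. *)
Definition lin_indep (R : pzRingType) (V : lmodType R) (I : eqType)
    (A : I -> Prop) (f : I -> V) : Prop :=
  forall (s : seq I) (c : I -> R),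
    uniq s -> (forall i, i \in s -> A i) ->
    \sum_(i <- s) c i *: f i = 0 -> forall i, i \in s -> c i = 0.

(* The 2n variables x_1, .., x_n, y_1, .., y_n, in that order. *)
Definition xvar n (i : 'I_n) : 'I_(n + n) := lshift n i.
Definition yvar n (i : 'I_n) : 'I_(n + n) := rshift n i.

Definition hook_biexponents (K L : nat) : seq (nat * nat) :=
  [seq (0%N, q) | q <- iota 0 K.+1] ++ [seq (p, 0%N) | p <- iota 1 L].

(* Throughout, n = (K + L).+1. *)
Definition hook_Delta (K L : nat) : {mpoly rat[(K + L).+1 + (K + L).+1]} :=
  \det (\matrix_(i < (K + L).+1, j < (K + L).+1)
          let pq := nth (0%N, 0%N) (hook_biexponents K L) j in
          'X_(xvar i) ^+ pq.1 * 'X_(yvar i) ^+ pq.2).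

Section Drawings.
Variables K L : nat.

Section Columns.
(* Y is the set of places of the y-columns, and m i the number of crosses in
   the column at place i; places are numbered from 0. *)
Variables (Y : {set 'I_(K + L)}) (m : 'I_(K + L) -> nat).

Definition cells (i : 'I_(K + L)) : nat :=
  if i \in Y then (K - #|[set j in Y | j < i]|)%N
  else (L - #|[set j in ~: Y | j < i]|)%N.

Definition empty_col (i : 'I_(K + L)) : bool := m i == 0%N.
Definition full_col (i : 'I_(K + L)) : bool := m i == cells i.

Definition plain_xcol (i : 'I_(K + L)) : bool :=
  (i \notin Y) && (full_col i || empty_col i).

Definition first_plain_right (i j : 'I_(K + L)) : Prop :=
  [/\ (i < j)%N, plain_xcol j &
      forall k : 'I_(K + L), (i < k < j)%N -> ~~ plain_xcol k].

(* A y-column with an x-column to its right has a plain x-column to its right,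
   since the last x-column has a single cell; the condition below is vacuous
   for the other y-columns. *)
Definition ycol_rule (i : 'I_(K + L)) : Prop :=
  forall j, first_plain_right i j ->
    (empty_col j -> (0 < m i)%N) /\ (full_col j -> (m i < cells i)%N).

End Columns.

Record drawing := Drawing {
  ycols : {set 'I_(K + L)};
  crosses : 'I_(K + L) -> nat;
  card_ycols : #|ycols| = K;
  crosses_le_cells : forall i, (crosses i <= cells ycols i)%N;
  ycols_rule : forall i, i \in ycols -> ycol_rule ycols crosses i
}.

(* A diagram gives at each place the numbers of crossed x-cells and of crossed
   y-cells. *)
Definition diagram := {ffun 'I_(K + L) -> nat * nat}.

Definition cross_diagram (D : drawing) : diagram :=
  [ffun i => if i \in ycols D then (0%N, crosses D i)
             else (crosses D i, 0%N)].

Definition is_cross_diagram (S : diagram) : Prop :=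
  exists D : drawing, cross_diagram D = S.

(* Place i carries the variables x_i and y_i; x_n and y_n are at no place. *)
Definition place_index (i : 'I_(K + L)) : 'I_(K + L).+1 :=
  widen_ord (leqnSn _) i.

Definition diagram_mnm (S : diagram) : 'X_{1..(K + L).+1 + (K + L).+1} :=
  (\sum_(i < K + L) (U_(xvar (place_index i)) *+ (S i).1
                     + U_(yvar (place_index i)) *+ (S i).2))%MM.

Definition partial_diagram (S : diagram)
    (p : {mpoly rat[(K + L).+1 + (K + L).+1]}) :
    {mpoly rat[(K + L).+1 + (K + L).+1]} :=
  p^`M[diagram_mnm S].

End Drawings.

(* Main.v *)
(** For diagrams S and W, the coefficient of the monomial of W in
    [partial_diagram S (hook_Delta K L)] is nonzero iff the exponents S + W
    occur in [hook_Delta K L], which happens when W consists of the white cells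
    of a drawing with cross diagram S.  Hence a linear dependency produces a
    cycle of drawings D_i in which the crosses of D_(i+1) and the white cells of
    D_i add up to an exponent of the determinant, while the cross diagrams of
    D_i and D_(i+1) differ.  Such a cycle cannot exist: going through the places
    from left to right, one shows that all these sums use at each place the
    largest degree still available, and that the numbers of remaining x-columns
    of the drawings, once they are not all equal, never become all equal again.
    As no x-column remains at the end, they always are equal, and so are all the
    cross diagrams. *)

Require Import Defs.
From mathcomp Require Import all_boot all_order all_algebra.
From mathcomp Require Import fingroup perm zify.
From mathcomp Require Import mpoly.

Set Implicit Arguments.
Unset Strict Implicit.
Unset Printing Implicit Defensive.

Import GRing.Theory.

(** * One place of a cycle of drawings *)

Section Step.
Variable I : finType.

(* I indexes the drawings D i of the cycle, and the crosses of D (nxt i) are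
   added to the white cells of D i.  At a given place, r i is the number of
   x-columns of D i from this place on, m the minimum of the r i, and e i tells
   whether the first plain x-column of D i from this place on is empty (rather
   than full).  The x-degrees not yet used by the sum of D (nxt i) and D i are
   1, .., rho i. *)
Definition level_inv (nxt : I -> I) (m : nat) (r rho : I -> nat)
    (e : I -> bool) : Prop :=
  [/\ exists i, r i = m,
      forall i, m <= r i,
      forall i, ~~ [&& m < r i, ~~ e i, m < r (nxt i) & e (nxt i)] &
      forall i, rho i = if (m < r i) && ~~ e i then r i
                        else if (m < r (nxt i)) && e (nxt i) then r (nxt i)
                        else m].

(* With R places left, y i is the type of the column of D i (true for y), s i
   and w i its numbers of crosses and of white cells, e' i the value of e i at
   the next place, and z i the type of the sum s (nxt i) + w i. *)
Record place_data (nxt : I -> I) (R : nat) (y z : I -> bool)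
    (s w r rho : I -> nat) (e e' : I -> bool) : Prop := PlaceData {
  pd_level : forall i, r i <= R;
  pd_cells : forall i, s i + w i = if y i then R - r i else r i;
  pd_gt0 : forall i, 0 < s i + w i;
  pd_empty : forall i, ~~ y i -> s i = 0 -> e i;
  pd_full : forall i, ~~ y i -> w i = 0 -> ~~ e i;
  pd_next : forall i, y i || (0 < s i) && (0 < w i) -> e' i = e i;
  pd_rule : forall i, y i -> 0 < r i -> if e i then 0 < s i else 0 < w i;
  pd_pure_s : forall i, 0 < s (nxt i) -> z i = y (nxt i);
  pd_pure_w : forall i, 0 < w i -> z i = y i;
  pd_sum_gt0 : forall i, 0 < s (nxt i) + w i;
  pd_cap : forall i, s (nxt i) + w i <= if z i then R - rho i else rho i
}.

(** The last disjunction chains from place to place: unequal levels rule out its second alternative,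
    hence stay unequal. *)
Definition place_concl (nxt : I -> I) (R m : nat) (y z : I -> bool)
    (s w r rho : I -> nat) (e' : I -> bool) : Prop :=
  (forall i, s (nxt i) + w i = if z i then R - rho i else rho i) /\
  exists m', level_inv nxt m' (fun i => r i - ~~ y i)
                      (fun i => rho i - ~~ z i) e' /\
    ((exists i, m' < r i - ~~ y i) \/
     (forall i, r i = m) /\ forall i, y (nxt i) = y i /\ s (nxt i) = s i).

Variable nxt : I -> I.
(** This makes [nxt] a single cycle: iterating it leads from any index to any other. *)
Hypothesis nxt_ind :
  forall P : I -> Prop, (forall i, P i -> P (nxt i)) -> forall i j, P i -> P j.

Lemma prv_ind (P : I -> Prop) :
  (forall i, P (nxt i) -> P i) -> forall i j, P i -> P j.
Proof.
move=> clP i j Pi.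
have := @nxt_ind (fun k => P k -> P j) _ j i; apply=> // k kj Pk.
by apply: kj; apply: clP.
Qed.

Section Data.
Variables (R m : nat) (y z : I -> bool) (s w r rho : I -> nat) (e e' : I -> bool).
Hypothesis data : place_data nxt R y z s w r rho e e'.
Hypothesis inv : level_inv nxt m r rho e.

(* A column is full-like if it is full or, when the drawing has more x-columns
   left than the minimum and the next plain one is full, if it has at least as
   many crosses as a full column of a drawing with m x-columns left.  Being
   full-like propagates backwards along the cycle, being empty-like forwards. *)
Let high_full i := (m < r i) && ~~ e i.
Let high_empty i := (m < r i) && e i.
Let low_cells i := if y i then R - m else m.
Let full_like i := if high_full i then low_cells i <= s i else w i == 0.
Let empty_like i := if high_empty i then low_cells i <= w i else s i == 0.

Ltac place i :=
  move: (pd_level data i) (pd_cells data i) (pd_gt0 data i)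
    (pd_next data (i := i)) (pd_empty data (i := i))
    (pd_full data (i := i)) (pd_rule data (i := i));
  case: inv => _ + _ _; move=> /(_ i).
Ltac edge i :=
  move: (pd_pure_s data (i := i)) (pd_pure_w data (i := i))
    (pd_sum_gt0 data i) (pd_cap data i);
  case: inv => _ _ + +; move=> /(_ i) + /(_ i); place i; place (nxt i).
Ltac decide_edge i :=
  rewrite /full_like /empty_like /high_full /high_empty /low_cells;
  case: (ltnP m (r i)); case: (ltnP m (r (nxt i)));
  case: (y i); case: (y (nxt i)); case: (z i); case: (e i); case: (e (nxt i)) => //=;
  lia.

(** The crosses of a full-like successor use up the cap on the sum, so [i] has no white cell; if [i]
    is high full, the cap is [r i] and leaves room for at most [r i - m] of them. *)
Lemma full_like_prev i : full_like (nxt i) -> full_like i.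
Proof. by edge i; decide_edge i. Qed.

Lemma empty_like_next i : empty_like i -> empty_like (nxt i).
Proof. by edge i; decide_edge i. Qed.

(** A sum has a single type, so either [i] has no white cell or its successor has no cross. *)
Lemma type_change i : y i <> y (nxt i) -> full_like i \/ empty_like (nxt i).
Proof. by edge i; decide_edge i. Qed.

Let intermediate := (forall i, ~~ full_like i) /\ (forall i, ~~ empty_like i).

Lemma intermediate_type i j : intermediate -> y i = y j.
Proof.
move=> [nPf nP0]; apply: (nxt_ind (P := fun k => y i = y k)) (erefl _) => k ->.
by apply/eqP/negPn/negP => /eqP /type_change []; apply/negP.
Qed.

(* R is only added in order to avoid truncated subtractions. *)
Let rank i := if high_empty i then low_cells i + R - w i else s i + R.

(** As all types agree, the cap on the sum at [i] amounts to exactly this inequality, in each of the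
    three cases of [rho]. Equal ranks therefore mean that the cap is attained. *)
Lemma rank_next i : intermediate -> rank (nxt i) <= rank i.
Proof.
move=> mf; have := intermediate_type i (nxt i) mf; case: mf => nPf nP0.
move: (nPf i) (nPf (nxt i)) (nP0 i) (nP0 (nxt i)); rewrite /rank; edge i.
decide_edge i.
Qed.

Lemma rank_const i : intermediate -> rank (nxt i) = rank i.
Proof.
move=> mf; apply/eqP; rewrite eqn_leq rank_next //=.
apply: (nxt_ind (P := fun k => rank k <= rank (nxt i))) (leqnn _) => k.
by apply: leq_trans; apply: rank_next.
Qed.

Lemma intermediate_greedy i : intermediate ->
  s (nxt i) + w i = (if z i then R - rho i else rho i) /\ z i = y i.
Proof.
move=> mf; have := intermediate_type i (nxt i) mf; have := rank_const i mf.
case: mf => nPf nP0.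
move: (nPf i) (nPf (nxt i)) (nP0 i) (nP0 (nxt i)); rewrite /rank; edge i.
decide_edge i.
Qed.

Lemma intermediate_high i :
  intermediate -> m < r i -> ~~ y i -> (0 < s i) && (0 < w i).
Proof.
move=> [nPf nP0]; move: (nPf i) (nP0 i); place i.
rewrite /full_like /empty_like /high_full /high_empty /low_cells.
by case: (ltnP m (r i)); case: (y i); case: (e i) => /=; lia.
Qed.

(** Induction along the cycle from a drawing of minimal level, which is not high. If [k] is not high
    full, it has no white cell and the cap is [m]; if it is, the cap is [r k] and by induction [k]
    has at least [r k - m] white cells. *)
Lemma full_like_bound : (forall i, full_like i) -> forall i, high_full i -> s i <= m.
Proof.
move=> allPf i.
have [j rj] : exists j, r j = m by case: inv.
apply: (nxt_ind (P := fun k => high_full k -> s k <= m))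
  (_ : high_full j -> s j <= m); last first.
  by rewrite /high_full rj ltnn.
move=> k; move: (allPf k) (allPf (nxt k)); edge k; decide_edge k.
Qed.

Lemma full_like_greedy i : (forall i, full_like i) ->
  s (nxt i) + w i = if z i then R - rho i else rho i.
Proof.
move=> allPf; have := full_like_bound allPf (i := i).
have := full_like_bound allPf (i := nxt i).
move: (allPf i) (allPf (nxt i)); edge i; decide_edge i.
Qed.

(** A high full column is here an x-column with white cells, so the crosses of its successor lie in
    an x-column too, which forces the successor to be high full. Going round the cycle reaches a
    drawing of minimal level, which is not high. *)
Lemma full_like_no_high_full :
  (forall i, full_like i) -> (forall i, r i = m -> y i) ->
  forall i, ~~ high_full i.
Proof.
move=> allPf lowy i; apply/negP => hfi.
have [j rj] : exists j, r j = m by case: inv.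
suff: high_full j by rewrite /high_full rj ltnn.
apply: (nxt_ind (P := high_full)) hfi => k.
have := full_like_bound allPf (i := k).
have := full_like_bound allPf (i := nxt k).
move: (allPf k) (allPf (nxt k)) (lowy (nxt k)); edge k; decide_edge k.
Qed.

(** All levels drop by the same amount, so the same drawings stay high, and no high drawing passes a
    plain x-column. If none is high, all columns have the same height and greedy sums force equal
    crosses. *)
Lemma uniform_step (b : bool) : (forall i, y i = b) -> (forall i, z i = b) ->
  (forall i, ~~ b -> m < r i -> (0 < s i) && (0 < w i)) ->
  (forall i, s (nxt i) + w i = if z i then R - rho i else rho i) ->
  place_concl nxt R m y z s w r rho e'.
Proof.
move=> yb zb high greedy; split=> //.
have [j rj] : exists j, r j = m by case: inv.
have m0 : ~~ b -> 0 < m.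
  by move=> nb; place j; rewrite yb; case: (b) nb => //= _; lia.
have hiE k : (m - ~~ b < r k - ~~ b) = (m < r k).
  by move: m0; place k; case: (b) => /=; lia.
have eE k : m < r k -> e' k = e k.
  move=> rk; apply: (pd_next data); rewrite yb.
  by case: (boolP b) => //= nb; apply: high.
case: (inv) => _ _ excl rhoE; exists (m - ~~ b); split; first split.
- by exists j; rewrite yb rj.
- by move=> i; rewrite yb; place i; lia.
- move=> i; move: (excl i); rewrite !yb !hiE.
  by case: ltnP => //= /eE->; case: (e i) => //=; case: ltnP => //= /eE->.
- move=> i; rewrite !yb zb rhoE !hiE.
  case: (ltnP m (r i)) => [/eE->|_]; case: (ltnP m (r (nxt i))) => [/eE->|_] //=;
  by do ?case: ifP.
case: (boolP [exists i, m < r i]) => [/existsP[i ri]|/existsPn nhi].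
  by left; exists i; rewrite yb; move: m0; case: (b) => /=; lia.
right; split=> [i|i].
  by apply/eqP; rewrite eqn_leq leqNgt nhi /=; case: inv => _ /(_ i).
split; first by rewrite !yb.
move: (nhi i) (nhi (nxt i)) (greedy i); edge i; rewrite !yb !zb.
case: (ltnP m (r i)); case: (ltnP m (r (nxt i))); case: (b) => //=; lia.
Qed.

Lemma full_like_step : (forall i, full_like i) -> place_concl nxt R m y z s w r rho e'.
Proof.
move=> allPf; have bnd := full_like_bound allPf.
case: (boolP [exists i, (r i == m) && ~~ y i])
  => [/existsP[j /andP[/eqP rj yj]]|/existsPn lowy].
  split; first by move=> i; apply: full_like_greedy.
  have m0 : 0 < m by place j; rewrite (negPf yj); lia.
  (* The minimum drops to [m.-1]; above it lie the drawings that were high and those with a y-column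
     here. *)
  have hiE k : (m.-1 < r k - ~~ y k) = (m < r k) || y k.
    by move: m0; place k; case: (y k) => /=; lia.
  have eE k : (m < r k) || y k -> e' k = e k.
    move=> hk; apply: (pd_next data); move: hk (allPf k) (bnd k); place k.
    rewrite /full_like /high_full /low_cells.
    by case: (ltnP m (r k)); case: (y k); case: (e k) => /=; lia.
  have andE k : ((m < r k) || y k) && e' k = ((m < r k) || y k) && e k.
    by case: (boolP (_ || _)) => // /eE->.
  have andNE k : ((m < r k) || y k) && ~~ e' k = ((m < r k) || y k) && ~~ e k.
    by case: (boolP (_ || _)) => // /eE->.
  exists m.-1; split; first split.
  - by exists j; rewrite rj yj; lia.
  - by move=> i; place i; case: (y i) => /=; lia.
  - move=> i; rewrite !hiE andE [_ && [&& _, _ & _]]andbA andNE.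
    move: (bnd i) (bnd (nxt i)) (allPf i) (allPf (nxt i)); edge i; decide_edge i.
  - move=> i; rewrite !hiE andE andNE.
    move: (bnd i) (bnd (nxt i)) (allPf i) (allPf (nxt i)); edge i; decide_edge i.
  case: (boolP [exists i, (m < r i) || y i]) => [/existsP[i ri]|/existsPn ni].
    by left; exists i; move: ri; case: (y i) => /=; place i; lia.
  right; split => [i|i].
    by move: (ni i); place i; lia.
  move: (ni i) (ni (nxt i)) (allPf i) (allPf (nxt i)); edge i; decide_edge i.
(* Now no drawing is high full, and a high empty one has no white cell, hence no x-column: all
   columns are y-columns. *)
have lowy' i : r i = m -> y i.
  by move=> ri; move: (lowy i); rewrite ri eqxx /= negbK.
have nhf := full_like_no_high_full allPf lowy'.
have ally i : y i.
  move: (lowy' i) (allPf i) (nhf i); place i.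
  rewrite /full_like /high_full /low_cells.
  by case: (ltnP m (r i)); case: (y i); case: (e i) => //=; lia.
apply: (uniform_step (b := true)) => // i; last exact: full_like_greedy.
by move: (nhf i) (allPf i) (ally i) (ally (nxt i)); edge i; decide_edge i.
Qed.

Lemma step_or_empty_like :
  place_concl nxt R m y z s w r rho e' \/ forall i, empty_like i.
Proof.
case: (boolP [exists i, full_like i]) => [/existsP[i Pfi]|/existsPn nPf].
  left; apply: full_like_step => j.
  by apply: (@prv_ind full_like) Pfi; apply: full_like_prev.
case: (boolP [exists i, empty_like i]) => [/existsP[i P0i]|/existsPn nP0].
  by right=> j; apply: (nxt_ind (P := empty_like)) P0i; apply: empty_like_next.
left; have [i0 _] : exists i, r i = m by case: inv.
have mf : intermediate by [].
apply: (uniform_step (b := y i0)) => [i|i|i yi ri|i].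
- exact: intermediate_type.
- by have [_ ->] := intermediate_greedy i mf; apply: intermediate_type.
- by apply: intermediate_high => //; rewrite (intermediate_type i i0).
- by have [] := intermediate_greedy i mf.
Qed.

End Data.
End Step.

(* Exchanging crosses and white cells turns a drawing into a drawing, and
   reverses the cycle. *)
Section Duality.
Variables (I : finType) (nxt prv : I -> I).
Hypothesis prvK : cancel prv nxt.

(** Duality swaps the two tests in the formula for [rho]; they exclude each other by the third
    clause of [level_inv]. *)
Lemma level_inv_dual m r rho rho' (e e' : I -> bool) :
  level_inv nxt m r rho e -> (forall i, rho' i = rho (prv i)) ->
  (forall i, e' i = ~~ e i) -> level_inv prv m r rho' e'.
Proof.
move=> [lowest low excl rhoE] rho'E e'E; split=> // i.
  rewrite !e'E negbK; move: (excl (prv i)); rewrite prvK.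
  by apply: contra => /and4P[-> -> -> ->].
rewrite !e'E negbK rho'E rhoE prvK; move: (excl (prv i)); rewrite prvK.
by case: ltnP => _; case: ltnP => _; case: (e i); case: (e (prv i)).
Qed.

Lemma place_data_dual R y z s w r rho e e' :
  place_data nxt R y z s w r rho e e' ->
  place_data prv R y (z \o prv) w s r (rho \o prv) (negb \o e) (negb \o e').
Proof.
case=> level cells gt0 empty full next rule pure_s pure_w sum_gt0 cap.
split=> /= i.
- exact: level.
- by rewrite addnC.
- by rewrite addnC.
- exact: full.
- by move=> ? ?; rewrite negbK; apply: empty.
- by rewrite andbC => /next ->.
- by rewrite if_neg; apply: rule.
- exact: pure_w.
- by move: (pure_s (prv i)); rewrite prvK.
- by rewrite addnC -{1}[i]prvK.
- by rewrite addnC -{1}[i]prvK.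
Qed.

End Duality.

Lemma place_step (I : finType) (nxt prv : I -> I)
    (nxtK : cancel nxt prv) (prvK : cancel prv nxt)
    (nxt_ind : forall P : I -> Prop,
       (forall i, P i -> P (nxt i)) -> forall i j, P i -> P j)
    R m y z s w r rho e e' :
  place_data nxt R y z s w r rho e e' -> level_inv nxt m r rho e ->
  place_concl nxt R m y z s w r rho e'.
Proof.
move=> data inv; case: (step_or_empty_like nxt_ind data inv) => // allP0.
have prv_ind' (P : I -> Prop) :
    (forall i, P i -> P (prv i)) -> forall i j, P i -> P j.
  by move=> clP; apply: (prv_ind nxt_ind) => i /clP; rewrite nxtK.
have ddata := place_data_dual prvK data.
have dinv : level_inv prv m r (rho \o prv) (negb \o e).
  exact: (level_inv_dual prvK inv).
(* Empty-like columns are the full-like columns of the reversed cycle. *)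
have [|greedy [m' [inv' high']]] := full_like_step prv_ind' ddata dinv.
  by move=> i /=; rewrite negbK; apply: allP0.
split=> [i|].
  by move: (greedy (nxt i)); rewrite /= nxtK addnC.
exists m'; split.
  by apply: (level_inv_dual nxtK inv') => i /=; rewrite ?nxtK ?negbK.
case: high' => [|[low same]]; [by left|right; split=> // i].
have [/= yE wE] := same (nxt i); rewrite nxtK in yE wE; split=> //.
move: (pd_cells data i) (pd_cells data (nxt i)).
by rewrite yE wE !low => <- /addIn.
Qed.

(** * Coefficients of the derivatives of the determinant *)

Section Coefficients.
Variables K L : nat.
Local Notation n := (K + L).+1.

Definition hook_exponent (j : nat) : nat * nat :=
  nth (0, 0) (hook_biexponents K L) j.

Lemma hook_exponentE j : j < n ->
  hook_exponent j = if j <= K then (0, j) else (j - K, 0).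
Proof.
move=> jn; rewrite /hook_exponent /hook_biexponents nth_cat size_map size_iota ltnS.
case: leqP => jK.
  by rewrite (nth_map 0) ?size_iota // nth_iota.
by rewrite (nth_map 0) ?size_iota ?nth_iota; try lia; congr (_, _); lia.
Qed.

Lemma hook_exponent_inj (j k : 'I_n) : hook_exponent j = hook_exponent k -> j = k.
Proof.
rewrite !hook_exponentE // => eq_jk; apply: val_inj => /=.
case: leqP eq_jk => jK; case: leqP => kK [] //; lia.
Qed.

Lemma xvar_eq (i j : 'I_n) : (xvar i == xvar j) = (i == j).
Proof. exact: (inj_eq (@lshift_inj _ _)). Qed.

Lemma yvar_eq (i j : 'I_n) : (yvar i == yvar j) = (i == j).
Proof. exact: (inj_eq (@rshift_inj _ _)). Qed.

Definition hook_mnm (sigma : 'S_n) : 'X_{1..n + n} :=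
  (\sum_(i < n) (U_(xvar i) *+ (hook_exponent (sigma i)).1
                 + U_(yvar i) *+ (hook_exponent (sigma i)).2))%MM.

Lemma hook_mnm_xvar sigma i : hook_mnm sigma (xvar i) = (hook_exponent (sigma i)).1.
Proof.
rewrite mnm_sumE (bigD1 i) //= mnmDE !mulmnE !mnm1E eqxx eq_rlshift mul1n addn0.
rewrite big1 ?addn0 // => j /negPf ji.
by rewrite mnmDE !mulmnE !mnm1E xvar_eq ji eq_rlshift.
Qed.

Lemma hook_mnm_yvar sigma i : hook_mnm sigma (yvar i) = (hook_exponent (sigma i)).2.
Proof.
rewrite mnm_sumE (bigD1 i) //= mnmDE !mulmnE !mnm1E eqxx eq_lrshift mul1n add0n.
rewrite big1 ?addn0 // => j /negPf ji.
by rewrite mnmDE !mulmnE !mnm1E yvar_eq ji eq_lrshift.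
Qed.

Lemma hook_mnm_inj : injective hook_mnm.
Proof.
move=> s t eq_st; apply/permP => i; apply: hook_exponent_inj.
apply: injective_projections; first by rewrite -!hook_mnm_xvar eq_st.
by rewrite -!hook_mnm_yvar eq_st.
Qed.

Lemma mcoeff_hook_Delta mm :
  ((hook_Delta K L)@_mm = \sum_(s : 'S_n) (-1) ^+ s * (hook_mnm s == mm)%:R)%R.
Proof.
rewrite /hook_Delta /determinant raddf_sum; apply: eq_bigr => s _ /=.
have ->: (\prod_i (\matrix_(i0, j) ('X_(xvar i0) ^+ (hook_exponent j).1
    * 'X_(yvar i0) ^+ (hook_exponent j).2)) i (s i))%R
    = 'X_[hook_mnm s] :> {mpoly rat[n + n]}.
  by rewrite -mprodXE; apply: eq_bigr => i _; rewrite mxE mpolyXD !mpolyXn.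
by rewrite !mulr_sign; case: ifP => _; rewrite ?mcoeffN mcoeffX.
Qed.

(** Distinct permutations give distinct monomials, so no terms of the determinant cancel. *)
Lemma mcoeff_hook_mnm s : ((hook_Delta K L)@_(hook_mnm s) != 0)%R.
Proof.
rewrite mcoeff_hook_Delta (bigD1 s) //= eqxx big1 => [|t /negPf ts].
  by rewrite addr0 mulr1 signr_eq0.
by rewrite (inj_eq hook_mnm_inj) ts mulr0.
Qed.

Lemma mcoeff_hook_Delta_neq0 mm :
  ((hook_Delta K L)@_mm != 0)%R -> exists s, hook_mnm s = mm.
Proof.
rewrite mcoeff_hook_Delta => nz.
case: (boolP [exists s, hook_mnm s == mm]) => [/existsP[s /eqP <-]|/existsPn nmm].
  by exists s.
by case/eqP: nz; rewrite big1 // => s _; rewrite (negPf (nmm s)) mulr0.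
Qed.

Lemma place_index_inj : injective (@place_index K L).
Proof. by move=> i j /(congr1 val) /= ?; apply: val_inj. Qed.

Lemma diagram_mnm_xvar (S : diagram K L) i :
  diagram_mnm S (xvar (place_index i)) = (S i).1.
Proof.
rewrite mnm_sumE (bigD1 i) //= mnmDE !mulmnE !mnm1E eqxx eq_rlshift mul1n addn0.
rewrite big1 ?addn0 // => j /negPf ji.
by rewrite mnmDE !mulmnE !mnm1E xvar_eq (inj_eq place_index_inj) ji eq_rlshift.
Qed.

Lemma diagram_mnm_yvar (S : diagram K L) i :
  diagram_mnm S (yvar (place_index i)) = (S i).2.
Proof.
rewrite mnm_sumE (bigD1 i) //= mnmDE !mulmnE !mnm1E eqxx eq_lrshift mul1n add0n.
rewrite big1 ?addn0 // => j /negPf ji.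
by rewrite mnmDE !mulmnE !mnm1E yvar_eq (inj_eq place_index_inj) ji eq_lrshift.
Qed.

Lemma place_index_neq_max (i : 'I_(K + L)) : (place_index i == ord_max) = false.
Proof. by apply/negP => /eqP /(congr1 val) /=; have := ltn_ord i; lia. Qed.

Lemma diagram_mnm_max (S : diagram K L) :
  diagram_mnm S (xvar ord_max) = 0 /\ diagram_mnm S (yvar ord_max) = 0.
Proof.
split; rewrite mnm_sumE big1 // => j _; rewrite mnmDE !mulmnE !mnm1E.
  by rewrite xvar_eq place_index_neq_max eq_rlshift.
by rewrite yvar_eq place_index_neq_max eq_lrshift.
Qed.

(** There are [K + L] nonzero biexponents, so each is used exactly once: these are the monomials of
    the determinant whose last row contributes [(0, 0)]. *)
Definition hook_filling (T : 'I_(K + L) -> nat * nat) : Prop :=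
  injective T /\
  forall p, (T p).1 * (T p).2 = 0 /\ 0 < (T p).1 + (T p).2 /\
            (T p).1 <= L /\ (T p).2 <= K.

Definition overlay (S W : diagram K L) (p : 'I_(K + L)) : nat * nat :=
  ((S p).1 + (W p).1, (S p).2 + (W p).2).

Lemma overlay_filling (S W : diagram K L) :
  ((partial_diagram S (hook_Delta K L))@_(diagram_mnm W) != 0)%R ->
  hook_filling (overlay S W).
Proof.
rewrite mcoeff_mderivm => nz.
have /mcoeff_hook_Delta_neq0[s sE] :
    ((hook_Delta K L)@_(diagram_mnm S + diagram_mnm W) != 0)%R.
  by apply: contraNneq nz => ->; rewrite mul0rn.
have TE p : overlay S W p = hook_exponent (s (place_index p)).
  apply: injective_projections.
    by rewrite -hook_mnm_xvar sE mnmDE !diagram_mnm_xvar.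
  by rewrite -hook_mnm_yvar sE mnmDE !diagram_mnm_yvar.
have smax : s ord_max = ord0.
  apply: hook_exponent_inj; apply: injective_projections.
    by rewrite -hook_mnm_xvar sE mnmDE !(proj1 (diagram_mnm_max _)).
  by rewrite -hook_mnm_yvar sE mnmDE !(proj2 (diagram_mnm_max _)).
split=> [p q|p].
  by rewrite !TE => /hook_exponent_inj/perm_inj/place_index_inj.
have : s (place_index p) != ord0.
  by rewrite -smax (inj_eq perm_inj) place_index_neq_max.
rewrite TE hook_exponentE //; move: (s _) => j; rewrite -val_eqE /= => nz0.
by have := ltn_ord j; case: (leqP j K) => /=; lia.
Qed.

Lemma filling_overlay (S W : diagram K L) :
  hook_filling (overlay S W) ->
  ((partial_diagram S (hook_Delta K L))@_(diagram_mnm W) != 0)%R.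
Proof.
move=> [Tinj Tval]; rewrite mcoeff_mderivm.
(* [code] inverts [hook_exponent], and [T'] completes the overlay by [(0, 0)] in the last row. *)
pose code (ab : nat * nat) := if ab.1 == 0 then ab.2 else K + ab.1.
pose T' (i : 'I_n) := if insub (val i) is Some p then overlay S W p else (0, 0).
have T'E p : T' (place_index p) = overlay S W p by rewrite /T' /= valK.
have T'max : T' ord_max = (0, 0) by rewrite /T' insubF //= ltnn.
have place_or_max (i : 'I_n) : i = ord_max \/ exists p, i = place_index p.
  have [iN|Ni] := ltnP i (K + L); last first.
    by left; apply/eqP; rewrite -val_eqE eqn_leq /= Ni andbT -ltnS ltn_ord.
  by right; exists (Ordinal iN); apply: val_inj.
have codeK i : code (T' i) < n /\ hook_exponent (code (T' i)) = T' i.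
  have codelt : code (T' i) < n.
    case: (place_or_max i) => [->|[p ->]]; first by rewrite T'max.
    rewrite T'E /code; move: (Tval p); case: (overlay S W p) => a b /=.
    by case: eqP; lia.
  split=> //; rewrite hook_exponentE //.
  case: (place_or_max i) => [->|[p ->]]; first by rewrite T'max.
  rewrite T'E /code; move: (Tval p); case: (overlay S W p) => a b /=.
  move=> [ab0 [_ [_ bK]]]; case: eqP => [->|a0]; first by rewrite bK.
  by rewrite leqNgt (_ : K < K + a) /=; last lia; congr (_, _); nia.
have T'inj : injective T'.
  move=> i j; case: (place_or_max i) => [->|[p ->]];
    case: (place_or_max j) => [->|[q ->]] //.
  - by rewrite T'max T'E => T0; move: (Tval q); rewrite -T0 /=; lia.
  - by rewrite T'max T'E => T0; move: (Tval p); rewrite T0 /=; lia.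
  - by rewrite !T'E => /Tinj ->.
pose h i : 'I_n := inord (code (T' i)).
have hE i : hook_exponent (h i) = T' i.
  by have [lt eq] := codeK i; rewrite /h inordK.
have hinj : injective h by move=> i j hij; apply: T'inj; rewrite -!hE hij.
have eq_mnm : (diagram_mnm S + diagram_mnm W)%MM = hook_mnm (perm hinj).
  apply/mnmP => k; case: (split_ordP k) => i ->; rewrite mnmDE.
    rewrite [RHS]hook_mnm_xvar permE hE.
    case: (place_or_max i) => [->|[p ->]].
      by rewrite !(proj1 (diagram_mnm_max _)) T'max.
    by rewrite !diagram_mnm_xvar T'E.
  rewrite [RHS]hook_mnm_yvar permE hE.
  case: (place_or_max i) => [->|[p ->]].
    by rewrite !(proj2 (diagram_mnm_max _)) T'max.
  by rewrite !diagram_mnm_yvar T'E.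
(* The derivative contributes falling factorials, nonzero because the exponents of [S] are at most
   those of the sum. *)
rewrite -mulr_natr mulf_neq0 //; first by rewrite eq_mnm mcoeff_hook_mnm.
rewrite (Num.Theory.pnatr_eq0 rat) -lt0n prodn_gt0 // => i.
by rewrite ffact_gt0 mnmDE leq_addr.
Qed.

End Coefficients.

(** * Cycles of drawings *)

Section Levels.
Variables K L : nat.
Local Notation N := (K + L).
Implicit Types Y : {set 'I_N}.

Definition xlevel Y (p : nat) : nat := #|[set j in ~: Y | p <= j]|.

Lemma xlevelS Y (i : 'I_N) : xlevel Y i = (i \notin Y) + xlevel Y i.+1.
Proof.
rewrite /xlevel (cardsD1 i) !inE leqnn andbT; congr (_ + _).
apply: eq_card => j; rewrite !inE [i < j]ltn_neqAle -val_eqE [val j == _]eq_sym.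
by case: (j \in Y); rewrite ?andbF //= andbC.
Qed.

Lemma xlevel_end Y : xlevel Y N = 0.
Proof.
apply/eqP; rewrite cards_eq0; apply/eqP/setP => j.
by rewrite !inE leqNgt ltn_ord andbF.
Qed.

Lemma card_places_after p : p <= N -> #|[set j : 'I_N | p <= j]| = N - p.
Proof.
move=> pN; transitivity (\sum_(p <= j < N) 1); last first.
  by rewrite sum_nat_const_nat muln1.
rewrite -sum1_card (big_nat_widenl p 0) // big_mkord.
by apply: eq_bigl => j; rewrite inE.
Qed.

Lemma xlevel_le Y p : p <= N -> xlevel Y p <= N - p.
Proof.
move=> pN; rewrite -card_places_after //; apply: subset_leq_card.
by apply/subsetP => j; rewrite !inE => /andP[].
Qed.

Lemma card_split Y (i : 'I_N) :
  #|[set j in Y | j < i]| + #|[set j in Y | i <= j]| = #|Y|.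
Proof.
rewrite -(cardsID [set j : 'I_N | j < i] Y); congr (_ + _); apply: eq_card => j.
  by rewrite !inE.
by rewrite !inE -leqNgt andbC.
Qed.

Lemma card_xcols Y : #|Y| = K -> #|~: Y| = L.
Proof. by move=> cY; have := cardsC Y; rewrite cY card_ord; lia. Qed.

(** Heights within a type decrease to 1, so a column has as many cells as there are columns of its
    type from its place on. *)
Lemma cellsE Y (i : 'I_N) : #|Y| = K ->
  cells Y i = if i \in Y then N - i - xlevel Y i else xlevel Y i.
Proof.
move=> cY; rewrite /cells; have := card_split Y i; have := card_split (~: Y) i.
rewrite cY card_xcols //; move=> cX cYi.
have : #|[set j in Y | i <= j]| + xlevel Y i = N - i.
  rewrite -card_places_after; last by have := ltn_ord i; lia.
  rewrite -(cardsID Y [set j : 'I_N | i <= j]).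
  by congr (_ + _); apply: eq_card => j; rewrite !inE // andbC.
rewrite -/(xlevel Y i) in cX; case: ifP => _; lia.
Qed.

Lemma xlevel0 Y : #|Y| = K -> xlevel Y 0 = L.
Proof.
move=> cY; rewrite -(card_xcols cY); apply: eq_card => j.
by rewrite !inE andbT.
Qed.

Lemma cells_gt0 Y (i : 'I_N) : #|Y| = K -> 0 < cells Y i.
Proof.
move=> cY; rewrite cellsE // xlevelS.
have := xlevel_le Y (ltn_ord i); have := ltn_ord i.
case: (i \in Y) => /=; lia.
Qed.

End Levels.

(** * The next plain x-column of a drawing *)

Section NextPlain.
Variables (K L : nat) (D : drawing K L).
Local Notation N := (K + L).
Local Notation Y := (ycols D).
Local Notation plain := (plain_xcol Y (crosses D)).

(** Also false when no x-column is left, whence the condition [0 < r i] in [pd_rule]. *)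
Definition next_plain_empty (p : nat) : bool :=
  [exists j : 'I_N, [&& p <= j, plain j, empty_col (crosses D) j &
    [forall k : 'I_N, (p <= k < j) ==> ~~ plain k]]].

Lemma next_plain_empty_xcol (i : 'I_N) :
  i \notin Y -> crosses D i = 0 -> next_plain_empty i.
Proof.
move=> iY mi; apply/existsP; exists i.
rewrite leqnn /plain_xcol /empty_col mi iY orbT.
by apply/forallP => k; apply/implyP; lia.
Qed.

Lemma next_plain_full_xcol (i : 'I_N) :
  i \notin Y -> crosses D i = cells Y i -> ~~ next_plain_empty i.
Proof.
move=> iY mi; apply/negP => /existsP[j /and4P[ij pj ej /forallP/(_ i)]].
rewrite leqnn /= /plain_xcol iY /full_col mi eqxx implybF -leqNgt => ji.
have eq_ij : i = j by apply/val_inj/anti_leq; rewrite ij ji.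
by have := cells_gt0 i (card_ycols D); move: ej; rewrite /empty_col -eq_ij mi; lia.
Qed.

Lemma next_plain_emptyS (i : 'I_N) :
  ~~ plain i -> next_plain_empty i.+1 = next_plain_empty i.
Proof.
move=> npi; apply/existsP/existsP => -[j /and4P[ij pj ej /forallP nj]];
  exists j; rewrite pj ej /=.
  rewrite (ltnW ij); apply/forallP => k; apply/implyP => /andP[ik kj].
  have [<- //|ne] := eqVneq i k; apply: (implyP (nj k)).
  by rewrite kj ltn_neqAle ik val_eqE ne.
have ne : i != j by apply: contraNneq npi => ->.
rewrite ltn_neqAle ij val_eqE ne; apply/forallP => k; apply/implyP => /andP[ik kj].
by apply: (implyP (nj k)); rewrite kj ltnW.
Qed.

Lemma next_plain_empty_rule (i : 'I_N) :
  i \in Y -> next_plain_empty i -> 0 < crosses D i.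
Proof.
move=> iY /existsP[j /and4P[ij pj ej /forallP nj]].
have fp : first_plain_right Y (crosses D) i j.
  split=> // [|k /andP[ik kj]].
    rewrite ltn_neqAle ij andbT; apply/negP => /eqP /val_inj eq_ij.
    by move: pj; rewrite /plain_xcol -eq_ij iY.
  by apply: (implyP (nj k)); rewrite kj ltnW.
by have [+ _] := ycols_rule iY fp; apply.
Qed.

(** The last x-column has a single cell and so is plain. *)
Lemma next_plain_exists (i : 'I_N) :
  0 < xlevel Y i -> exists j : 'I_N, i <= j /\ plain j.
Proof.
rewrite card_gt0 => /set0Pn[j0 j0X].
have [j jX jmax] := @arg_maxnP _ j0 (mem [set j in ~: Y | i <= j]) val j0X.
exists j; have /andP[jY ij] : (j \notin Y) && (i <= j) by move: jX; rewrite !inE.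
split=> //; rewrite /plain_xcol jY /full_col /empty_col /=.
have := crosses_le_cells D j; rewrite cellsE ?card_ycols // (negPf jY) xlevelS jY.
suff -> : xlevel Y j.+1 = 0 by lia.
apply/eqP; rewrite cards_eq0; apply/eqP/setP => k; rewrite !inE.
apply/negP => /andP[kY jk].
have := jmax k; rewrite !inE kY (leq_trans ij (ltnW jk)) => /(_ isT) /=; lia.
Qed.

Lemma next_plain_full_rule (i : 'I_N) :
  i \in Y -> 0 < xlevel Y i -> ~~ next_plain_empty i ->
  crosses D i < cells Y i.
Proof.
move=> iY /next_plain_exists[j0 [ij0 pj0]] nne.
have Pj0 : plain j0 && (i <= j0) by rewrite pj0.
have [j /andP[pj ij] jmin] :=
  @arg_minnP _ j0 (fun j => plain j && (i <= j)) val Pj0.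
have nj (k : 'I_N) : i <= k < j -> ~~ plain k.
  move=> /andP[ik kj]; apply/negP => pk.
  by have := jmin k; rewrite pk ik => /(_ isT) /=; rewrite leqNgt kj.
have fp : first_plain_right Y (crosses D) i j.
  split=> // [|k /andP[ik kj]]; last by apply: nj; rewrite kj ltnW.
  rewrite ltn_neqAle ij andbT; apply/negP => /eqP /val_inj eq_ij.
  by move: pj; rewrite /plain_xcol -eq_ij iY.
have [_ +] := ycols_rule iY fp; apply.
move: (pj) => /andP[_ /orP[//|ej]]; case/negP: nne.
apply/existsP; exists j; rewrite ij pj ej /=.
by apply/forallP => k; apply/implyP; apply: nj.
Qed.

End NextPlain.

(** * Induction over the places of a cycle of drawings *)

Section Cycle.
Variables (K L : nat).
Local Notation N := (K + L).

Definition white_diagram (D : drawing K L) : diagram K L :=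
  [ffun i => if i \in ycols D then (0, cells (ycols D) i - crosses D i)
             else (cells (ycols D) i - crosses D i, 0)].

Variables (I : finType) (nxt prv : I -> I).
Hypotheses (nxtK : cancel nxt prv) (prvK : cancel prv nxt).
Hypothesis nxt_ind :
  forall P : I -> Prop, (forall i, P i -> P (nxt i)) -> forall i j, P i -> P j.
Variable i0 : I.

Variable D : I -> drawing K L.
Let T i := overlay (cross_diagram (D (nxt i))) (white_diagram (D i)).
Hypothesis fill : forall i, hook_filling (T i).

Let xl p i := xlevel (ycols (D i)) p.
Let ne p i := next_plain_empty (D i) p.

(** The covering clauses say that all degrees beyond the caps are used up. Of the [N - p] degrees
    left, [rho i] are x-degrees and the others y-degrees. *)
Definition greedy_upto p : Prop := exists m rho,
  [/\ level_inv nxt m (xl p) rho (ne p),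
      forall i v, rho i < v <= L -> exists2 q : 'I_N, q < p & T i q = (v, 0),
      forall i v, N - p - rho i < v <= K ->
        exists2 q : 'I_N, q < p & T i q = (0, v) &
      (exists i, m < xl p i) \/
      forall q : 'I_N, q < p -> forall i,
        (q \in ycols (D (nxt i))) = (q \in ycols (D i)) /\
        crosses (D (nxt i)) q = crosses (D i) q].

Lemma greedy0 : greedy_upto 0.
Proof.
have x0 i : xl 0 i = L by apply: xlevel0; apply: card_ycols.
exists L, (fun=> L); split; [|lia|lia|by right].
by split=> [|i|i|i]; first exists i0; rewrite ?x0 ?ltnn.
Qed.

Lemma greedyS (p : 'I_N) : greedy_upto p -> greedy_upto p.+1.
Proof.
move=> [m [rho [inv covx covy same]]].
pose y i := p \in ycols (D i); pose s i := crosses (D i) p.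
pose w i := cells (ycols (D i)) p - crosses (D i) p.
pose z i := (T i p).1 == 0.
have TE i : T i p =
    ((if y (nxt i) then 0 else s (nxt i)) + (if y i then 0 else w i),
     (if y (nxt i) then s (nxt i) else 0) + (if y i then w i else 0)).
  by rewrite /T /overlay !ffunE -/(y _) -/(y _); case: (y i); case: (y (nxt i)).
have Tz i : T i p = if z i then (0, s (nxt i) + w i) else (s (nxt i) + w i, 0).
  have [_ /(_ p)] := fill i; rewrite /z TE /=.
  by case: (y i); case: (y (nxt i)) => /= Tv; do ?case: ifP => ?; congr (_, _); nia.
have sw i : s i + w i = cells (ycols (D i)) p by rewrite subnKC // crosses_le_cells.
have data : place_data nxt (N - p) y z s w (xl p) rho (ne p) (ne p.+1).
  split=> i.
  - by apply: xlevel_le; apply: ltnW.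
  - by rewrite sw cellsE ?card_ycols.
  - by rewrite sw cells_gt0 ?card_ycols.
  - exact: next_plain_empty_xcol.
  - by move=> yi wi; apply: next_plain_full_xcol => //; rewrite -sw wi addn0.
  - move=> nonplain; apply: next_plain_emptyS; rewrite /plain_xcol -/(y i).
    move: nonplain; case: (y i) => //=.
    by rewrite /full_col /empty_col -sw -/(s i); lia.
  - move=> yi xi; case: ifPn => nei; first exact: next_plain_empty_rule.
    by rewrite subn_gt0; apply: next_plain_full_rule.
  - have [_ /(_ p)] := fill i; rewrite /z TE /=.
    case: (y i); case: (y (nxt i)) => /=; nia.
  - have [_ /(_ p)] := fill i; rewrite /z TE /=.
    case: (y i); case: (y (nxt i)) => /=; nia.
  - by have [_ /(_ p)] := fill i; rewrite Tz; case: (z i) => /=; lia.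
  (* A degree above the cap already occurs at an earlier place, against injectivity. *)
  - have [Tinj /(_ p)] := fill i; rewrite Tz => Tv.
    rewrite leqNgt; apply/negP => big.
    have [q qp Tq] : exists2 q : 'I_N, q < p & T i q = T i p.
      rewrite Tz; move: Tv big; case: (z i) => /= Tv big.
        by apply: covy; rewrite big; lia.
      by apply: covx; rewrite big; lia.
    by move: qp; rewrite (Tinj _ _ Tq) ltnn.
have [grd [m' [inv' high']]] := place_step nxtK prvK nxt_ind data inv.
have xlS i : xl p.+1 i = xl p i - ~~ y i.
  by rewrite /xl [xlevel _ p]xlevelS -/(y i) addKn.
exists m', (fun i => rho i - ~~ z i); split.
- case: inv' => [[j jE] low excl rhoE]; split=> [|i|i|i]; rewrite ?xlS //.
  by exists j; rewrite xlS.
- move=> i v v_bnd; have := grd i; have := pd_sum_gt0 data i; have := Tz i.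
  case: (z i) v_bnd => /= v_bnd TzE pos gE.
    by case: (covx i v) => [|q qp Tq]; [lia|exists q => //; apply: ltnW].
  have [v_le|v_eq] : rho i < v \/ v = rho i by lia.
    by case: (covx i v) => [|q qp Tq]; [lia|exists q => //; apply: ltnW].
  by exists p => //; rewrite TzE gE v_eq.
- move=> i v v_bnd; have := grd i; have := pd_sum_gt0 data i; have := Tz i.
  case: (z i) v_bnd => /= v_bnd TzE pos gE; last first.
    by case: (covy i v) => [|q qp Tq]; [lia|exists q => //; apply: ltnW].
  have [v_le|v_eq] : N - p - rho i < v \/ v = N - p - rho i by lia.
    by case: (covy i v) => [|q qp Tq]; [lia|exists q => //; apply: ltnW].
  by exists p => //; rewrite TzE gE v_eq.
case: high' => [[i hi]|[low samep]]; first by left; exists i; rewrite xlS.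
case: same => [[i]|same]; first by rewrite low ltnn.
right=> q; rewrite ltnS leq_eqVlt => /orP[/eqP/val_inj ->|]; last exact: same.
exact: samep.
Qed.

Lemma cycle_constant i : cross_diagram (D (nxt i)) = cross_diagram (D i).
Proof.
have grd p : p <= N -> greedy_upto p.
  elim: p => [_|p IHp pN]; first exact: greedy0.
  by apply: (greedyS (p := Ordinal pN)); apply: IHp; apply: ltnW.
(* After the last place all levels are 0, so none exceeds the minimum. *)
have [m [rho [_ _ _ [[j]|same]]]] := grd N (leqnn _).
  by rewrite /xl xlevel_end.
by apply/ffunP => q; rewrite !ffunE; have [-> ->] := same q (ltn_ord q) i.
Qed.

End Cycle.

(** * From a linear dependency to a cycle of drawings *)

Lemma xlevel_bounds K L (Y : {set 'I_(K + L)}) p q : p <= q <= K + L ->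
  xlevel Y q <= xlevel Y p <= xlevel Y q + (q - p).
Proof.
move=> /andP[/subnK <-]; elim: (q - p) => [|d IHd] dN.
  by rewrite add0n subnn addn0 leqnn.
have /andP[le1 le2] := IHd (ltnW dN).
have := xlevelS Y (Ordinal dN) : xlevel Y (d + p) = _ + xlevel Y (d + p).+1.
rewrite addSn; case: (_ \in _) => /=; lia.
Qed.

(** Crosses and white cells of one drawing make up whole columns, of heights [K, ..., 1] and
    [L, ..., 1]. *)
Lemma drawing_filling K L (D : drawing K L) :
  hook_filling (overlay (cross_diagram D) (white_diagram D)).
Proof.
have cY := card_ycols D.
have TE p : overlay (cross_diagram D) (white_diagram D) p =
    if p \in ycols D then (0, cells (ycols D) p) else (cells (ycols D) p, 0).
  by rewrite /overlay !ffunE; case: ifP => _ /=; rewrite subnKC ?crosses_le_cells.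
have cells_decr (p q : 'I_(K + L)) : p < q -> (p \in ycols D) = (q \in ycols D) ->
    cells (ycols D) q < cells (ycols D) p.
  move=> pq pYq; have qN : p.+1 <= q <= K + L by rewrite pq ltnW.
  have := xlevel_bounds (ycols D) qN; have := cells_gt0 q cY.
  rewrite !cellsE // -pYq (xlevelS _ p); have := xlevel_le (ycols D) (ltn_ord p).
  have := ltn_ord q; case: (p \in ycols D) => /=; lia.
split=> [p q|p].
  rewrite !TE => eq_T.
  have pYq : (p \in ycols D) = (q \in ycols D).
    move: eq_T; have := cells_gt0 p cY; have := cells_gt0 q cY.
    by case: (p \in _); case: (q \in _) => //= gq gp []; lia.
  have eq_cells : cells (ycols D) p = cells (ycols D) q.
    by move: eq_T; rewrite -pYq; case: (p \in _) => -[].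
  case: (ltngtP p q) => [pq|qp|/val_inj //].
    by have := cells_decr _ _ pq pYq; rewrite eq_cells ltnn.
  by have := cells_decr _ _ qp (esym pYq); rewrite eq_cells ltnn.
rewrite TE; have := cells_gt0 p cY; have pN := ltnW (ltn_ord p).
have := @xlevel_bounds _ _ (ycols D) 0 p; rewrite xlevel0 // pN => /(_ isT).
by rewrite cellsE //; case: (p \in _) => /=; lia.
Qed.

Lemma ordS_ind n (P : 'I_n.+1 -> Prop) :
  (forall i, P i -> P (ordS i)) -> forall i j, P i -> P j.
Proof.
move=> clP i j Pi.
have Padd k : forall a : 'I_n.+1, P a ->
    forall b : 'I_n.+1, b = a + k %[mod n.+1] -> P b.
  elim: k => [|k IHk] a Pa b.
    by rewrite addn0 !modn_small // => /val_inj ->.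
  rewrite addnS -addSn => eq_b; apply: (IHk _ (clP _ Pa)).
  by rewrite eq_b /= modnDml.
(* This many steps lead from [i] to [j] modulo [n.+1], also when [j < i]. *)
apply: (Padd (n.+1 - i + j) i Pi); rewrite addnA subnKC ?modnDl //.
exact: ltnW.
Qed.

Lemma iter_periodic (J : finType) (g : J -> J) (x0 : J) :
  exists n x, iter n.+1 g x = x.
Proof.
pose f (k : 'I_#|J|.+1) := iter k g x0.
have /injectivePn[a [b ne_ab eq_f]] : ~~ injectiveb f.
  by apply/negP => /injectiveP /leq_card; rewrite card_ord ltnn.
wlog ab : a b ne_ab eq_f / a < b.
  move=> wl; have [ab|ba|/val_inj eq_ab] := ltngtP a b; first exact: (wl a b).
    by apply: (wl b a) => //; rewrite eq_sym.
  by rewrite eq_ab eqxx in ne_ab.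
exists (b - a).-1, (iter a g x0).
by rewrite prednK ?subn_gt0 // -iterD subnK ?(ltnW ab) // eq_f.
Qed.

Theorem theorem3 (K L : nat) :
  lin_indep (@is_cross_diagram K L)
    (fun S : diagram K L => partial_diagram S (hook_Delta K L)).
Proof.
move=> s c us sA sum0 S0 S0s; apply/eqP/negPn/negP => cS0.
pose supp := [seq S <- s | c S != 0%R].
(* The white cells of a drawing of [x] give a monomial that also occurs in the derivative for
   another diagram of the support. *)
pose linked (x : seq_sub supp) (Dy : drawing K L * seq_sub supp) :=
  [/\ cross_diagram Dy.1 = ssval x, ssval Dy.2 <> ssval x &
      hook_filling (overlay (ssval Dy.2) (white_diagram Dy.1))].
have [f fP] : exists f, forall x, linked x (f x).
  apply: (fin_all_exists (P := linked)) => -[S /= Ssupp].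
  have /andP[cS Ss] : (c S != 0%R) && (S \in s) by rewrite mem_filter in Ssupp.
  have [D DS] := sA S Ss.
  pose W := diagram_mnm (white_diagram D).
  pose M S' := ((partial_diagram S' (hook_Delta K L))@_W)%R.
  have [/hasP[S' S's /and3P[neS cS' MS']]|/hasPn noS'] :=
    boolP (has (fun S' => [&& S' != S, c S' != 0%R & M S' != 0%R]) s).
    have S'supp : S' \in supp by rewrite mem_filter cS'.
    by exists (D, SeqSub S'supp); split=> //=; [apply/eqP | apply: overlay_filling].
  (* Otherwise only [S] contributes to the coefficient of [W] in the dependency, and it contributes
     a nonzero amount. *)
  have MS : M S != 0%R.
    by apply: filling_overlay; rewrite -DS; apply: drawing_filling.
  case/negP: (mulf_neq0 cS MS); apply/eqP.
  transitivity (\sum_(S' <- s) c S' * M S')%R.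
    rewrite (bigD1_seq S) //= big_seq_cond big1 ?addr0 // => S' /andP[/noS' + neS].
    rewrite neS /=; case: eqP => [->|_]; first by rewrite mul0r.
    by rewrite negbK => /eqP ->; rewrite mulr0.
  rewrite -[RHS](mcoeff0 _ W) -sum0 raddf_sum.
  by apply: eq_bigr => S' _; rewrite /= mcoeffZ.
have S0supp : S0 \in supp by rewrite mem_filter cS0.
pose g x := (f x).2.
have [n [x gx]] := iter_periodic g (SeqSub S0supp).
(* The drawings along a periodic orbit of [g], on which [ordS] acts as the successor since [g]
   returns to [x] after [n.+1] steps. *)
pose D (i : 'I_n.+1) := (f (iter i g x)).1.
have nxtE (i : 'I_n.+1) : iter (ordS i) g x = g (iter i g x).
  have [lt_in|ge_in] := ltnP i n; first by rewrite /= modn_small.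
  have iE : i = n :> nat by apply/eqP; rewrite eqn_leq ge_in -ltnS ltn_ord.
  by rewrite /= iE modnn; exact: esym gx.
have crossD i : cross_diagram (D i) = ssval (iter i g x) by case: (fP (iter i g x)).
have fill i :
    hook_filling (overlay (cross_diagram (D (ordS i))) (white_diagram (D i))).
  by rewrite crossD nxtE; case: (fP (iter i g x)).
have := cycle_constant (@ordSK n.+1) (@ord_predK n.+1) (@ordS_ind n) ord0 fill ord0.
by rewrite !crossD nxtE; case: (fP (iter (@ord0 n) g x)).
Qed.
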